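(* Let $p_1,p_2\in(1,2]$ and let $p_1',p_2'$ be defined by $1/p_1+1/p_1'=1/p_2+1/p_2'=1$. The bivariate Laplace transform $\mathscr L_2$, defined by \[ \mathscr L_2f(x_1,x_2)=\int_0^\infty\int_0^\infty e^{-x_1t_1-x_2t_2}f(t_1,t_2)\,dt_1\,dt_2,\quad x_1>0,\ x_2>0, \] satisfies, for every Lebesgue measurable (real- or complex-valued) function $f$ on $(0,\infty)^2$ with $\|f\|_{L^{(p_2,p_1)}}<\infty$, the permuted mixed norm inequality \[ \|\mathscr L_2f\|_{L^{(p_1',p_2')}}\le C(p_1)C(p_2)\,\|f\|_{L^{(p_2,p_1)}}, \] that is, \[ \left(\int_0^\infty\left(\int_0^\infty|\mathscr L_2f(x_1,x_2)|^{p_1'}\,dx_1\right)^{p_2'/p_1'}dx_2\right)^{1/p_2'} \le C(p_1)C(p_2)\left(\int_0^\infty\left(\int_0^\infty|f(t_1,t_2)|^{p_2}\,dt_2\right)^{p_1/p_2}dt_1\right)^{1/p_1}. \] Here $C(p)$ is the norm of the single-variable Laplace transform as a map from $L^p$ to $L^{p'}$.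
   Context: All spaces are with respect to Lebesgue measure on $(0,\infty)$. The single-variable Laplace transform is $\mathscr Lf(x)=\int_0^\infty e^{-xt}f(t)\,dt$, $x>0$. For $1<p\le2$ and $1/p+1/p'=1$, $C(p)$ is the least constant such that $\|\mathscr Lf\|_{L^{p'}(0,\infty)}\le C(p)\|f\|_{L^p(0,\infty)}$ for all $f\in L^p(0,\infty)$; it is well known to be finite. The mixed norms are \[ \|h\|_{L^{(p_1',p_2')}}=\left(\int_0^\infty\left(\int_0^\infty|h(x_1,x_2)|^{p_1'}\,dx_1\right)^{p_2'/p_1'}dx_2\right)^{1/p_2'} \] (inner integration in the first variable) and \[ \|f\|_{L^{(p_2,p_1)}}=\left(\int_0^\infty\left(\int_0^\infty|f(t_1,t_2)|^{p_2}\,dt_2\right)^{p_1/p_2}dt_1\right)^{1/p_1} \] (inner integration in the second variable). *)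

(* Defs.v *)
From HB Require Import structures.
From mathcomp Require Import all_boot all_order all_algebra.
From mathcomp Require Import all_classical all_reals all_analysis.
From mathcomp Require Import measurable_realfun complex.

Set Implicit Arguments.
Unset Strict Implicit.
Unset Printing Implicit Defensive.

Import Order.TTheory GRing.Theory Num.Theory.
Import numFieldNormedType.Exports.

Local Open Scope classical_set_scope.
Local Open Scope ring_scope.
Local Open Scope complex_scope.

                                                                        
                                                                                
                                                                               
                                                                              
                                                                        
              
Definition completed_measurable_fun {d} {T : measurableType d} {R : realType}
    (mu : {measure set T -> \bar R}) (D : set T) (f : T -> R[i]) : Prop :=
  forall B : set R, measurable B ->
    completed_algebra_gen mu (D `&` (fun x => complex.Re (f x)) @^-1` B) /\
    completed_algebra_gen mu (D `&` (fun x => complex.Im (f x)) @^-1` B).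

Definition Cintegral {d} {T : measurableType d} {R : realType}
    (mu : {measure set T -> \bar R}) (D : set T) (f : T -> R[i]) : R[i] :=
  (\int[mu]_(x in D) complex.Re (f x)) +i* (\int[mu]_(x in D) complex.Im (f x)).

Section laplace.
Context {R : realType}.
Local Notation mu := (@lebesgue_measure R).
Local Notation pos := (`]0%R, +oo[%classic : set R).
Local Notation normc := (@ComplexField.Normc.normc R).

Definition lebesgue_measurable1 (f : R -> R[i]) : Prop :=
  completed_measurable_fun mu pos f.

Definition lebesgue_measurable2 (f : R * R -> R[i]) : Prop :=
  completed_measurable_fun (mu \x mu)%E (pos `*` pos) f.

Definition laplace (f : R -> R[i]) (x : R) : R[i] :=
  Cintegral mu pos (fun t => (expR (- (x * t)))%:C * f t).

Definition laplace2 (f : R * R -> R[i]) (x : R * R) : R[i] :=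
  Cintegral mu pos (fun t2 =>
    Cintegral mu pos (fun t1 =>
      (expR (- (x.1 * t1) - x.2 * t2))%:C * f (t1, t2))).

Definition Lp_norm (p : R) (f : R -> R[i]) : \bar R :=
  ((\int[mu]_(t in pos) (normc (f t) `^ p)%:E) `^ p^-1)%E.

                                                                            
                                                                                
Definition mixed_norm_1in (p q : R) (h : R * R -> R[i]) : \bar R :=
  ((\int[mu]_(x2 in pos)
      (\int[mu]_(x1 in pos) (normc (h (x1, x2)) `^ p)%:E) `^ (q / p)) `^ q^-1)%E.

Definition mixed_norm_2in (p q : R) (h : R * R -> R[i]) : \bar R :=
  ((\int[mu]_(x1 in pos)
      (\int[mu]_(x2 in pos) (normc (h (x1, x2)) `^ p)%:E) `^ (q / p)) `^ q^-1)%E.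

Definition laplace_bound (p q C : R) : Prop :=
  0 <= C /\
  forall f : R -> R[i], lebesgue_measurable1 f -> (Lp_norm p f < +oo)%E ->
    (Lp_norm q (laplace f) <= C%:E * Lp_norm p f)%E.

                                                                                 
Definition laplace_norm (p q : R) : \bar R :=
  ereal_inf [set C%:E | C in [set C : R | laplace_bound p q C]].

End laplace.

(* Main.v *)
(* Approximating [f] by a Borel function that agrees with it a.e., we may assume
   [f] Borel. Hölder's inequality in [t2], then in [t1], shows that the kernel
   times [f] is integrable, so by Fubini [laplace2 f (x1, x2)] is the Laplace
   transform at [x1] of [h x2 : t1 |-> laplace (f (t1, .)) x2]. The bound C(p1)
   applied for each [x2] leaves the norm of [h], taken in L^p1 in [t1], then in
   L^p2' in [x2]; as [p1 <= 2 <= p2'], Minkowski's integral inequality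
   exchanges these two norms, and the bound C(p2) applied for each [t1]
   concludes. *)
Require Import Defs.
From mathcomp Require Import all_boot all_order all_algebra.
From mathcomp Require Import all_classical all_reals all_analysis.
From mathcomp Require Import measurable_realfun complex.
From mathcomp Require Import lra.

Set Implicit Arguments.
Unset Strict Implicit.
Unset Printing Implicit Defensive.

Import Order.TTheory GRing.Theory Num.Theory.
Import numFieldNormedType.Exports.

Local Open Scope classical_set_scope.
Local Open Scope ring_scope.

(** The integrals are total operations: a nonnegative integrand gets its lower integral, a signed
    one the difference of those of its two parts, and a real-valued integral is [fine] of the
    result, so that an infinite value is read as 0. Two consequences shape the proof. Monotonicity
    and invariance under a.e. changes hold without measurability, so passing to a Borel
    representative changes neither side, although sections and inner integrals of [f] need not be
    measurable. On the other hand, no bound on a transform and no exchange of integrals can be used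
    before integrability is known, because [fine] would hide a divergence; this is why finiteness of
    the kernel integral is established with explicit constants before the sharp bounds enter. *)

Local Notation normc := (@ComplexField.Normc.normc _).

(** * Monotonicity and a.e. invariance of lower integrals *)

Section lower_integral.
Local Open Scope ereal_scope.
Context d (T : measurableType d) (R : realType).
Variable mu : {measure set T -> \bar R}.
Implicit Types (D : set T) (f g : T -> \bar R).

(* [filterS] for [{ae mu, _}]; with [mu] abstract, it also applies to
   [lebesgue_measure], where inference of the filter instance fails. *)
Lemma ae_imply (P Q : T -> Prop) : (forall x, P x -> Q x) ->
  {ae mu, forall x, P x} -> {ae mu, forall x, Q x}.
Proof. by move=> PQ; apply: filterS. Qed.

Import HBNNSimple.

(* The integral of a nonnegative function, measurable or not, is defined as the
   supremum over the simple functions below it: it is a lower integral. *)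
Lemma ae_ge0_le_lower_integral D f g :
  (forall x, D x -> 0 <= f x) -> (forall x, D x -> 0 <= g x) ->
  {ae mu, forall x, D x -> f x <= g x} ->
  \int[mu]_(x in D) f x <= \int[mu]_(x in D) g x.
Proof.
move=> f0 g0 [N [mN N0 subN]].
rewrite integral_mkcond [leRHS]integral_mkcond.
rewrite !ge0_integralTE//; [|exact: erestrict_ge0..].
apply: ge_ereal_sup => _ [h /= hf <-].
have mNC : measurable (~` N) by exact: measurableC.
(* Cutting [h] off on the null set [N] does not change its integral, and the result lies below [g]
   everywhere: where the inequality between [f] and [g] may fail, [h'] is 0. *)
pose h' : {nnsfun T >-> R} := mul_nnsfun h (indic_nnsfun R mNC).
have h'E x : h' x = (h x * \1_(~` N) x)%R by [].
apply: (@le_trans _ _ (sintegral mu h')); last first.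
  apply: ereal_sup_ubound; exists h' => // x; rewrite -[X in X <= _]/((h' x)%:E).
  rewrite h'E indicE; have [xN|xN] := boolP (x \in ~` N); last first.
    by rewrite mulr0; exact: erestrict_ge0.
  rewrite mulr1 (le_trans (hf x))// !patchE; case: ifPn => // xD.
  apply: contrapT => nfg; move: xN; rewrite inE; apply; apply: subN => /= fg.
  by apply: nfg; apply: fg; move: xD; rewrite inE.
rewrite -!integralT_nnsfun (@ge0_ae_eq_integral _ _ _ mu setT _ (EFin \o h'))//.
- exact/measurable_EFinP.
- exact/measurable_EFinP.
- by move=> x _; rewrite lee_fin.
- by move=> x _; rewrite /= lee_fin mulr_ge0.
exists N; split=> // x /= nx; apply: contrapT => xN; apply: nx => _ /=.
by rewrite -[RHS]/((h' x)%:E) h'E indicE mem_set// mulr1.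
Qed.

(** Positive and negative parts are nonnegative and agree a.e. as well, so monotonicity applies to
    each of them in both directions. *)
Lemma ae_eq_lower_integral D f g :
  ae_eq mu D f g -> \int[mu]_(x in D) f x = \int[mu]_(x in D) g x.
Proof.
move=> fg; have le_pn (f1 f2 : T -> \bar R) : ae_eq mu D f1 f2 ->
    \int[mu]_(x in D) f1^\+ x <= \int[mu]_(x in D) f2^\+ x /\
    \int[mu]_(x in D) f1^\- x <= \int[mu]_(x in D) f2^\- x.
  move=> f12; split; apply: ae_ge0_le_lower_integral => //;
    by apply: filterS f12 => x fx Dx; rewrite ?(funeposE, funenegE) fx.
have [p1 n1] := le_pn _ _ fg.
have [p2 n2] := le_pn _ _ (ae_eq_sym fg).
rewrite integralE [RHS]integralE.
by congr (_ - _); apply/eqP; rewrite eq_le ?p1 ?n1.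
Qed.

Lemma ae_eq_Rintegral D (f g : T -> R) :
  ae_eq mu D f g -> (\int[mu]_(x in D) f x = \int[mu]_(x in D) g x)%R.
Proof.
move=> fg; congr fine; apply: ae_eq_lower_integral.
by apply: filterS fg => x fx Dx; rewrite fx.
Qed.

End lower_integral.

(** * Borel representatives of functions measurable for the completed measure *)

Section completed_measurability.
Context d (T : measurableType d) (R : realType).
Variable mu : {measure set T -> \bar R}.
Implicit Types (D : set T) (u : T -> R) (f : T -> R[i]).

Definition Cmeasurable f :=
  measurable_fun setT (fun x => complex.Re (f x)) /\
  measurable_fun setT (fun x => complex.Im (f x)).

Lemma Cmeasurable_completed D f : measurable D -> Cmeasurable f ->
  completed_measurable_fun mu D f.
Proof.
move=> mD [mRe mIm] B mB; split.
- exists (D `&` (fun x => complex.Re (f x)) @^-1` B); last first.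
    by exists set0; [exact: negligible_set0|rewrite setU0].
  by apply: measurableI => //; rewrite -[X in measurable X]setTI; exact: mRe.
- exists (D `&` (fun x => complex.Im (f x)) @^-1` B); last first.
    by exists set0; [exact: negligible_set0|rewrite setU0].
  by apply: measurableI => //; rewrite -[X in measurable X]setTI; exact: mIm.
Qed.

(** Only the countably many level sets at rational heights have to be corrected. Their negligible
    errors lie together in one null set [M], and off [M] these level sets determine all the
    others. *)
Lemma completed_measurable_fun_setD D u : measurable D ->
  (forall B, measurable B -> completed_algebra_gen mu (D `&` u @^-1` B)) ->
  exists M, [/\ measurable M, mu M = 0%E & measurable_fun (D `\` M) u].
Proof.
move=> mD mu_.
(* [r] enumerates the rationals; a natural number that encodes none of them yields 0, which only
   repeats a level. *)
pose r n : R := ratr (odflt 0 (unpickle n)).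
have /choice[AM AMP] n : exists AM : set T * set T,
    [/\ measurable AM.1, mu.-negligible AM.2 &
       forall x, ~ AM.2 x -> (D x /\ r n < u x) <-> AM.1 x].
  have [A mA [N nN AN]] := mu_ _ (measurable_itv `]r n, +oo[).
  exists (A, N); split => // x /= Nx.
  have -> : (D x /\ r n < u x) = (A `|` N) x.
    by rewrite AN /= in_itv/= andbT.
  by split=> [[//|/Nx]|Ax]; [|left].
have [M [mM M0 subM]] : mu.-negligible (\bigcup_n (AM n).2).
  by apply: negligible_bigcup => k; case: (AMP k).
have mDM := measurableD mD mM.
exists M; split => // _.
apply: (measurability _ (RGenOInfty.measurableE R)) => //.
move=> _ [_ [x ->] <-].
(* A value exceeds [x] exactly when it exceeds some rational greater than [x]. *)
rewrite [X in measurable X](_ : _ =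
    (D `\` M) `&` \bigcup_(n in [set n | x < r n]) (AM n).1).
  by apply: measurableI => //; apply: bigcup_measurable => n _; case: (AMP n).
have inM n y : ~ M y -> ~ (AM n).2 y.
  by move=> My AMy; apply: My; apply: subM; exists n.
apply/seteqP; split=> y [[Dy My]] /=.
- rewrite in_itv/= andbT => /rat_in_itvoo[q]; rewrite in_itv/= => /andP[xq qu].
  split=> //; have rq : r (pickle q) = ratr q by rewrite /r pickleK.
  exists (pickle q); rewrite /= ?rq//.
  by have [_ _ /(_ y (inM _ _ My))<-] := AMP (pickle q); rewrite rq.
- move=> [n /= xr Any]; split=> //; rewrite in_itv/= andbT.
  have [_ _ /(_ y (inM _ _ My))H] := AMP n.
  by apply: lt_trans xr _; exact: (H.2 Any).2.
Qed.

(** The representative is [f] off the two exceptional null sets and 0 elsewhere, including outside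
    [D], so that it is Borel on the whole space and its sections need no domain conditions. *)
Lemma completed_measurable_fun_ae D f : measurable D ->
  completed_measurable_fun mu D f ->
  exists2 g, Cmeasurable g & ae_eq mu D f g.
Proof.
move=> mD mf.
have [M [mM M0 mRe]] :=
  completed_measurable_fun_setD mD (fun B mB => (mf B mB).1).
have [N [mN N0 mIm]] :=
  completed_measurable_fun_setD mD (fun B mB => (mf B mB).2).
pose E := D `\` (M `|` N).
have mE : measurable E by apply: measurableD => //; exact: measurableU.
exists (fun x => if x \in E then f x else 0).
- split.
  + rewrite [X in measurable_fun _ X](_ : _ = (fun x => complex.Re (f x)) \_ E).
      apply/(measurable_restrictT _ mE); apply: measurable_funS mRe.
        exact: measurableD.
      by move=> x [Dx /not_orP[]].
    by apply/funext => x; rewrite patchE; case: ifPn.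
  + rewrite [X in measurable_fun _ X](_ : _ = (fun x => complex.Im (f x)) \_ E).
      apply/(measurable_restrictT _ mE); apply: measurable_funS mIm.
        exact: measurableD.
      by move=> x [Dx /not_orP[]].
    by apply/funext => x; rewrite patchE; case: ifPn.
- exists (M `|` N); split=> [||x /= /not_implyP[Dx]].
  + exact: measurableU.
  + by apply: null_set_setU.
  + by case: ifPn => // /negP; rewrite inE => /not_andP[//|/contrapT].
Qed.

End completed_measurability.

(** * Powers of extended reals *)

Section poweR_monotone.
Local Open Scope ereal_scope.
Context (R : realType).

Lemma lee_poweR (r : R) (x y : \bar R) : (0 <= r)%R -> 0 <= x -> x <= y ->
  x `^ r <= y `^ r.
Proof.
move=> r0 x0 xy; apply: gt0_ler_poweR => //; rewrite in_itv/= ?leey ?x0//.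
by rewrite (le_trans x0 xy).
Qed.

Lemma poweRVK (r : R) (x : \bar R) : r != 0%R -> 0 <= x -> (x `^ r^-1) `^ r = x.
Proof. by move=> r0 x0; rewrite -poweRrM mulVf// poweRe1. Qed.

End poweR_monotone.

(** * Hölder's inequality on a measurable subset *)

Section hoelder_nonneg.
Local Open Scope ereal_scope.
Context d (T : measurableType d) (R : realType).
Variable mu : {measure set T -> \bar R}.

Lemma ge0_hoelder (D : set T) (u v : T -> R) (p q : R) : measurable D ->
  measurable_fun D u -> measurable_fun D v ->
  (forall x, 0 <= u x)%R -> (forall x, 0 <= v x)%R ->
  (0 < p)%R -> (0 < q)%R -> (p^-1 + q^-1 = 1)%R ->
  \int[mu]_(x in D) (u x * v x)%:E <=
  (\int[mu]_(x in D) (u x `^ p)%:E) `^ p^-1 *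
  (\int[mu]_(x in D) (v x `^ q)%:E) `^ q^-1.
Proof.
move=> mD mu_ mv u0 v0 p0 q0 pq.
have muD : measurable_fun setT (u \_ D) by exact/(measurable_restrictT _ mD).
have mvD : measurable_fun setT (v \_ D) by exact/(measurable_restrictT _ mD).
have := hoelder mu muD mvD p0 q0 pq.
have powE (w : T -> R) (s : R) : (forall x, 0 <= w x)%R -> (0 < s)%R ->
    'N[mu]_(s%:E)[EFin \o (w \_ D)] =
    (\int[mu]_(x in D) (w x `^ s)%:E) `^ s^-1.
  move=> w0 s0; rewrite unlock [in RHS]integral_mkcond; congr (_ `^ _).
  apply: eq_integral => x _; rewrite !patchE /= patchE.
  case: ifPn => _; first by rewrite ger0_norm.
  by rewrite normr0 powR0// gt_eqF.
rewrite Lnorm1 !powE//; apply: le_trans; rewrite [leLHS]integral_mkcond.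
rewrite le_eqVlt; apply/predU1P; left; apply: eq_integral => x _.
rewrite !patchE /= !patchE.
case: ifPn => _; first by rewrite ger0_norm// mulr_ge0.
by rewrite mulr0 normr0.
Qed.

End hoelder_nonneg.

(** * Minkowski's integral inequality *)

Section minkowski_integral.
Local Open Scope ereal_scope.
Context d1 d2 (X : measurableType d1) (Y : measurableType d2) (R : realType).
Variables (m1 : {sigma_finite_measure set X -> \bar R})
  (m2 : {sigma_finite_measure set Y -> \bar R}).
Variables (H : X * Y -> R) (r : R).
Hypotheses (mH : measurable_fun setT H) (H0 : forall z, (0 <= H z)%R).

Let Phi x := \int[m2]_y (H (x, y))%:E.
Let M := \int[m2]_y (\int[m1]_x (H (x, y) `^ r)%:E) `^ r^-1.

Let Phi0 x : 0 <= Phi x.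
Proof. by apply: integral_ge0 => y _; rewrite lee_fin. Qed.

(* For a minorant [phi], [I = \int phi^r] is finite: Fubini and Hölder give
   [I <= I^(1 - 1/r) * M], which can be divided by [I^(1 - 1/r)]. *)
Lemma minkowski_integral_minorant (phi : X -> R) : (1 < r)%R ->
  measurable_fun setT phi -> (forall x, 0 <= phi x)%R ->
  (forall x, (phi x)%:E <= Phi x) ->
  \int[m1]_x (phi x `^ r)%:E < +oo ->
  \int[m1]_x (phi x `^ r)%:E <= M `^ r.
Proof.
move=> r1 mphi phi0 phiPhi; set I := \int[m1]_x _ => Ioo.
have r0 : (0 < r)%R by exact: lt_trans r1.
have rN0 : r != 0%R by rewrite gt_eqF.
have I0 : 0 <= I by apply: integral_ge0 => x _; rewrite lee_fin powR_ge0.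
have [->|IN0] := eqVneq I 0; first exact: poweR_ge0.
have Igt0 : 0 < I by rewrite lt0e IN0.
(* [s] is the exponent conjugate to [r]. With [psi] the power r - 1 of [phi], the power [s] of [psi]
   is again phi^r, so Hölder gives back [I] itself. *)
pose s := (r / (r - 1))%R.
have r10 : (0 < r - 1)%R by rewrite subr_gt0.
have s0 : (0 < s)%R by rewrite divr_gt0.
have sr : (s^-1 + r^-1 = 1)%R.
  by rewrite /s invf_div mulrBl divff// mul1r addrNK.
pose psi x := (phi x `^ (r - 1))%R.
have psi0 x : (0 <= psi x)%R by rewrite powR_ge0.
have mpsi : measurable_fun setT psi.
  exact: (@measurableT_comp _ _ _ _ _ _ (@powR R ^~ (r - 1)%R)).
have psis x : (psi x `^ s = phi x `^ r)%R.
  by rewrite /psi -powRrM /s mulrCA divff ?mulr1// gt_eqF.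
have mpsiH : measurable_fun setT (fun z : X * Y => (psi z.1 * H z)%:E).
  apply/measurable_EFinP; apply: measurable_funM => //.
  exact: (measurableT_comp mpsi).
(* In phi^r = psi * phi only the last factor is bounded by [Phi]. Tonelli then moves the integral in
   [y] outside, and Hölder in [x] is applied for each [y]. *)
have I_le : I <= I `^ s^-1 * M.
  apply: (@le_trans _ _ (\int[m1]_x ((psi x)%:E * Phi x))).
    apply: ae_ge0_le_lower_integral => [x _|x _|].
    - by rewrite lee_fin powR_ge0.
    - by rewrite mule_ge0// lee_fin.
    apply: aeW => x _; have -> : (phi x `^ r = psi x * phi x)%R.
      rewrite -[X in (_ * X)%R](powRr1 (phi0 x)) -powRD ?subrK//.
      by rewrite (negPf rN0).
    by rewrite EFinM lee_wpmul2l// lee_fin.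
  rewrite (eq_integral (fun x => \int[m2]_y (psi x * H (x, y))%:E)); last first.
    move=> x _; rewrite -ge0_integralZl//.
    - apply/measurable_EFinP; exact: measurableT_comp.
    - by move=> y _; rewrite lee_fin.
    - by rewrite lee_fin.
  rewrite (fubini_tonelli (fun z => (psi z.1 * H z)%:E))//; last first.
    by move=> z; rewrite lee_fin mulr_ge0.
  rewrite -ge0_integralZl//; last 3 first.
    - apply: (measurableT_comp (measurable_poweR _)).
      apply: (measurable_fun_fubini_tonelli_G (fun z => (H z `^ r)%:E)) => //.
        apply/measurable_EFinP.
        exact: (@measurableT_comp _ _ _ _ _ _ (@powR R ^~ r)).
      by move=> z; rewrite lee_fin powR_ge0.
    - by move=> y _; exact: poweR_ge0.
    - exact: poweR_ge0.
  apply: ae_ge0_le_lower_integral => [y _|y _|].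
  - by apply: integral_ge0 => x _; rewrite lee_fin mulr_ge0.
  - by rewrite mule_ge0// poweR_ge0.
  apply: aeW => y _.
  rewrite /I -(eq_integral _ _ (fun x _ => congr1 EFin (psis x))).
  by apply: ge0_hoelder => //; exact: measurableT_comp.
have IM : I `^ r^-1 <= M.
  rewrite -(@lee_pmul2l _ (I `^ s^-1)) ?poweR_gt0//; last first.
    by rewrite fin_num_poweR// ge0_fin_numE.
  by rewrite -poweRD ?sr ?poweRe1// /poweRD_def sr oner_eq0.
rewrite -(poweRVK rN0 I0).
by apply: lee_poweR => //; [exact: ltW|exact: poweR_ge0].
Qed.

Import HBNNSimple.

(** The left-hand side is the supremum of the integrals of simple functions [h] below Phi^r. Such an
    integral may be infinite, while the bound for minorants needs a finite one; so [h] is restricted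
    to sets [S n] of finite measure that exhaust the space, and [n] tends to infinity. *)
Lemma minkowski_integral : (1 <= r)%R ->
  \int[m1]_x (\int[m2]_y (H (x, y))%:E) `^ r <=
  (\int[m2]_y (\int[m1]_x (H (x, y) `^ r)%:E) `^ r^-1) `^ r.
Proof.
(* For r = 1 there is no finite conjugate exponent, and the claim is Tonelli's theorem. *)
rewrite le_eqVlt => /predU1P[<-|r1].
  rewrite invr1 poweRe1; last first.
    by apply: integral_ge0 => y _; exact: poweR_ge0.
  rewrite (eq_integral Phi); last by move=> x _; exact/poweRe1/Phi0.
  rewrite (fubini_tonelli (EFin \o H))//; last exact/measurable_EFinP.
  apply: ae_ge0_le_lower_integral => [y _|y _|].
  - by apply: integral_ge0 => x _; rewrite /= lee_fin.
  - exact: poweR_ge0.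
  apply: aeW => y _; rewrite poweRe1; last first.
    by apply: integral_ge0 => x _; rewrite lee_fin powR_ge0.
  by under [leRHS]eq_integral do rewrite powRr1 ?H0//.
have r0 : (0 < r)%R by exact: lt_trans r1.
rewrite ge0_integralTE; last by move=> x; exact: poweR_ge0.
apply: ge_ereal_sup => _ [h /= hPhi <-]; rewrite -integralT_nnsfun.
have [S [ST ndS mS]] := (sigma_finiteP _ _).1 (sigma_finiteT m1).
have mh : measurable_fun setT (EFin \o h) by exact/measurable_EFinP.
have : \int[m1]_(x in S n) (h x)%:E @[n --> \oo] --> \int[m1]_x (h x)%:E.
  rewrite ST; apply: ge0_nondecreasing_set_cvg_integral => //.
  - by move=> i; case: (mS i).
  - by move=> i; exact: measurable_funTS.
  - by move=> i x _; rewrite lee_fin.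
move=> hcvg; rewrite -(cvg_lim _ hcvg)//; apply: lime_le.
  by apply/cvg_ex; eexists; exact: hcvg.
apply: nearW => n; have [mSn Snoo] := mS n.
(* The r-th root of the truncated [h] is a minorant of [Phi]; the integral of its r-th power is
   finite because [h] is bounded and [S n] has finite measure. *)
pose phi x := ((h \_ (S n)) x `^ r^-1)%R.
have hS0 x : (0 <= (h \_ (S n)) x)%R by rewrite patchE; case: ifPn.
have mhS : measurable_fun setT (h \_ (S n)).
  by apply/(measurable_restrictT _ mSn); exact: measurable_funTS.
have phir : \int[m1]_x (phi x `^ r)%:E = \int[m1]_(x in S n) (h x)%:E.
  rewrite [RHS]integral_mkcond; apply: eq_integral => x _.
  rewrite /phi -powRrM mulVf ?gt_eqF// powRr1//.
  by rewrite !patchE; case: ifPn.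
rewrite -phir; apply: minkowski_integral_minorant => //.
- exact: (@measurableT_comp _ _ _ _ _ _ (@powR R ^~ r^-1%R)).
- by move=> x; rewrite powR_ge0.
- move=> x; rewrite -[leRHS](@poweRVK _ r^-1) ?invr_eq0 ?gt_eqF// invrK.
  rewrite /phi -poweR_EFin; apply: lee_poweR.
  + by rewrite invr_ge0 ltW.
  + by rewrite lee_fin.
  rewrite patchE; case: ifPn => _; first exact: hPhi.
  exact: poweR_ge0.
- rewrite phir.
  have /integrableP[_] : m1.-integrable (S n) (EFin \o h).
    apply: measurable_bounded_integrable => //; first exact: measurable_funTS.
    have [B [Br /= hB]] := simple_bounded h.
    by exists B; split=> // y By x _; exact: (hB _ By).
  apply: le_lt_trans; apply: ae_ge0_le_lower_integral => [x _|x _|].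
  + by rewrite lee_fin.
  + by [].
  + by apply: aeW => x _ /=; rewrite ger0_norm.
Qed.

End minkowski_integral.

(** * Iterated integrals over rectangles and sections of null sets *)

Section iterated_integrals.
Local Open Scope ereal_scope.
Context d1 d2 (X : measurableType d1) (Y : measurableType d2) (R : realType).
Variables (m1 : {sigma_finite_measure set X -> \bar R})
  (m2 : {sigma_finite_measure set Y -> \bar R}).
Variables (D1 : set X) (D2 : set Y).
Hypotheses (mD1 : measurable D1) (mD2 : measurable D2).

(** Extension by zero off the rectangle turns integrals over [D1] and [D2] into integrals over the
    whole spaces, where Tonelli and Fubini are applied. *)
Lemma patch_setX (V : pointedType) (a : V) (k : X * Y -> V) x y :
  patch (fun=> a) (D1 `*` D2) k (x, y) =
  patch (fun=> a) D1 (fun x => patch (fun=> a) D2 (fun y => k (x, y)) y) x.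
Proof. by rewrite /patch in_setX; case: (x \in D1). Qed.

Lemma integral_patch1 (k : X * Y -> \bar R) x :
  \int[m2]_y (k \_ (D1 `*` D2)) (x, y) =
  ((fun x => \int[m2]_(y in D2) k (x, y)) \_ D1) x.
Proof.
rewrite patchE; case: ifPn => xD.
  rewrite [RHS]integral_mkcond; apply: eq_integral => y _.
  by rewrite patch_setX patchE xD.
rewrite -[RHS](integral0 m2 setT); apply: eq_integral => y _.
by rewrite patch_setX patchE (negPf xD).
Qed.

Lemma integral_patch2 (k : X * Y -> \bar R) y :
  \int[m1]_x (k \_ (D1 `*` D2)) (x, y) =
  ((fun y => \int[m1]_(x in D1) k (x, y)) \_ D2) y.
Proof.
rewrite patchE; case: ifPn => yD.
  rewrite [RHS]integral_mkcond; apply: eq_integral => x _.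
  by rewrite patch_setX !patchE yD.
rewrite -[RHS](integral0 m1 setT); apply: eq_integral => x _.
by rewrite patch_setX !patchE (negPf yD); case: ifP.
Qed.

Lemma measurable_fun_ge0_integral2 (k : X * Y -> \bar R) :
  measurable_fun setT k -> (forall z, 0 <= k z) ->
  measurable_fun setT (fun x => \int[m2]_(y in D2) k (x, y)).
Proof.
move=> mk k0.
rewrite [X in measurable_fun _ X](_ : _ =
    fun x => \int[m2]_y (k \_ (setT `*` D2)) (x, y)); last first.
  apply/funext => x; rewrite integral_mkcond; apply: eq_integral => y _.
  by rewrite !patchE in_setX in_setT.
apply: (measurable_fun_fubini_tonelli_F (k \_ (setT `*` D2))).
  apply/(measurable_restrictT _ (measurableX measurableT mD2)).
  exact: measurable_funTS.
by move=> z; apply: erestrict_ge0.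
Qed.

(** The integral is a difference of two Tonelli integrals, each measurable in [x], and [fine] is
    measurable; sections that are not integrable therefore do no harm. *)
Lemma measurable_fun_Rintegral2 (k : X * Y -> R) : measurable_fun setT k ->
  measurable_fun setT (fun x => \int[m2]_(y in D2) k (x, y))%R.
Proof.
move=> mk; apply: (measurableT_comp (fine_measurable measurableT)).
have mk' : measurable_fun setT (EFin \o k) by exact/measurable_EFinP.
under eq_fun do rewrite integralE.
apply: emeasurable_funB.
- rewrite (_ : (fun x => _) = fun x => \int[m2]_(y in D2) (EFin \o k)^\+ (x, y)).
    by apply: measurable_fun_ge0_integral2 => //; exact: measurable_funepos.
  by apply/funext => x; apply: eq_integral => y _; rewrite !funeposE.
- rewrite (_ : (fun x => _) = fun x => \int[m2]_(y in D2) (EFin \o k)^\- (x, y)).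
    by apply: measurable_fun_ge0_integral2 => //; exact: measurable_funeneg.
  by apply/funext => x; apply: eq_integral => y _; rewrite !funenegE.
Qed.

Lemma minkowski_integral_restrict (H : X * Y -> R) (r : R) :
  measurable_fun setT H -> (forall z, 0 <= H z)%R -> (1 <= r)%R ->
  \int[m1]_(x in D1) (\int[m2]_(y in D2) (H (x, y))%:E) `^ r <=
  (\int[m2]_(y in D2) (\int[m1]_(x in D1) (H (x, y) `^ r)%:E) `^ r^-1) `^ r.
Proof.
move=> mH H0 r1; have r0 : (0 < r)%R by exact: lt_le_trans r1.
have H0' z : (0 <= (H \_ (D1 `*` D2)) z)%R by rewrite patchE; case: ifPn.
have mH' : measurable_fun setT (H \_ (D1 `*` D2)).
  apply/(measurable_restrictT _ (measurableX mD1 mD2)).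
  exact: measurable_funTS.
have patchr (V : Type) (D : set V) (F : V -> \bar R) (s : R) v : s != 0%R ->
    (F \_ D) v `^ s = ((fun v => F v `^ s) \_ D) v.
  by move=> s0; rewrite !patchE; case: ifPn => // _; rewrite poweR0r.
have <- : \int[m1]_x (\int[m2]_y ((H \_ (D1 `*` D2)) (x, y))%:E) `^ r =
    \int[m1]_(x in D1) (\int[m2]_(y in D2) (H (x, y))%:E) `^ r.
  rewrite [RHS]integral_mkcond; apply: eq_integral => x _.
  rewrite -patchr ?gt_eqF//; congr (_ `^ _).
  rewrite -(integral_patch1 (EFin \o H)); apply: eq_integral => y _.
  by rewrite !patchE; case: ifPn.
have <- : \int[m2]_y (\int[m1]_x ((H \_ (D1 `*` D2)) (x, y) `^ r)%:E) `^ r^-1 =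
    \int[m2]_(y in D2) (\int[m1]_(x in D1) (H (x, y) `^ r)%:E) `^ r^-1.
  rewrite [RHS]integral_mkcond; apply: eq_integral => y _.
  rewrite -patchr ?gt_eqF ?invr_gt0//; congr (_ `^ _).
  rewrite -(integral_patch2 (fun z => (H z `^ r)%:E)); apply: eq_integral => x _.
  by rewrite !patchE; case: ifPn => // _; rewrite powR0 ?gt_eqF.
exact: minkowski_integral.
Qed.

Section fubini.
Variable k : X * Y -> R.
Hypotheses (mk : measurable_fun setT k)
  (ik : \int[m1]_(x in D1) \int[m2]_(y in D2) `|(k (x, y))%:E| < +oo).

Let k' := (EFin \o k) \_ (D1 `*` D2).

Let integrable_k' : (m1 \x m2).-integrable setT k'.
Proof.
apply/integrable12ltyP.
  apply/(measurable_restrictT _ (measurableX mD1 mD2)).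
  by apply: measurable_funTS; exact/measurable_EFinP.
move: ik; rewrite integral_mkcond; apply: le_lt_trans.
rewrite le_eqVlt; apply/predU1P; left; apply: eq_integral => x _.
rewrite -(integral_patch1 (fun z => `|(k z)%:E|)); apply: eq_integral => y _.
by rewrite /k' !patchE; case: ifPn => // _; rewrite abse0.
Qed.

Lemma ae_integrable_section1 :
  {ae m1, forall x, D1 x -> m2.-integrable D2 (fun y => (k (x, y))%:E)}.
Proof.
apply: filterS (ae_integrable1 integrable_k') => x ix D1x.
apply/(integrable_mkcond _ mD2); move: ix; congr (integrable _ _ _).
by apply/funext => y; rewrite /k' patch_setX patchE mem_set.
Qed.

Lemma ae_integrable_section2 :
  {ae m2, forall y, D2 y -> m1.-integrable D1 (fun x => (k (x, y))%:E)}.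
Proof.
apply: filterS (ae_integrable2 integrable_k') => y iy D2y.
apply/(integrable_mkcond _ mD1); move: iy; congr (integrable _ _ _).
by apply/funext => x; rewrite /k' patch_setX !patchE (mem_set D2y).
Qed.

(** The inner real-valued integral agrees with the extended one only where the section is
    integrable. The remaining sections form a null set, which the outer integral ignores. *)
Lemma Rintegral_Fubini :
  (\int[m2]_(y in D2) \int[m1]_(x in D1) k (x, y) =
   \int[m1]_(x in D1) \int[m2]_(y in D2) k (x, y))%R.
Proof.
rewrite /Rintegral; congr fine.
rewrite (@ae_eq_lower_integral _ _ _ m2 D2 _
    (fun y => \int[m1]_(x in D1) (k (x, y))%:E)); last first.
  apply: filterS ae_integrable_section2 => y iy D2y.
  by rewrite fineK//; exact: integrable_fin_num (iy D2y).
rewrite [RHS](@ae_eq_lower_integral _ _ _ m1 D1 _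
    (fun x => \int[m2]_(y in D2) (k (x, y))%:E)); last first.
  apply: filterS ae_integrable_section1 => x ix D1x.
  by rewrite fineK//; exact: integrable_fin_num (ix D1x).
rewrite integral_mkcond [RHS]integral_mkcond.
under eq_integral do rewrite -(integral_patch2 (EFin \o k)).
under [RHS]eq_integral do rewrite -(integral_patch1 (EFin \o k)).
by rewrite (Fubini integrable_k').
Qed.

End fubini.

(** The product measure of a set is the integral of the measures of its [x]-sections; if it is 0,
    almost all sections are null. *)
Lemma ae_xsection (P : X * Y -> Prop) : {ae (m1 \x m2), forall z, P z} ->
  {ae m1, forall x, {ae m2, forall y, P (x, y)}}.
Proof.
move=> [N [mN N0 subN]].
have mxN : measurable_fun setT (m2 \o xsection N).
  exact: measurable_fun_xsection.
have : \int[m1]_x `|(m2 \o xsection N) x| = 0.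
  by rewrite -[RHS]N0; apply: eq_integral => x _; rewrite gee0_abs.
move/(ae_eq_integral_abs _ measurableT mxN); apply: filterS => x /(_ I) /= Nx0.
exists (xsection N x); split => //; first exact: measurable_xsection.
by move=> y /= nP; rewrite /xsection /= inE; exact: subN.
Qed.

Lemma ae_ysection (P : X * Y -> Prop) : {ae (m1 \x m2), forall z, P z} ->
  {ae m2, forall y, {ae m1, forall x, P (x, y)}}.
Proof.
move=> [N [mN N0 subN]].
have myN : measurable_fun setT (m1 \o ysection N).
  exact: measurable_fun_ysection.
have : \int[m2]_y `|(m1 \o ysection N) y| = 0.
  (* The product measure is built from [x]-sections; by uniqueness it equals the one built from
     [y]-sections. *)
  rewrite -[RHS]N0 (@product_measure_unique _ _ _ _ _ m1 m2 (m1 \x^ m2))//.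
    by apply: eq_integral => y _; rewrite gee0_abs.
  by move=> A B mA mB; rewrite /= product_measure2E.
move/(ae_eq_integral_abs _ measurableT myN); apply: filterS => y /(_ I) /= Ny0.
exists (ysection N y); split => //; first exact: measurable_ysection.
by move=> x /= nP; rewrite /ysection /= inE; exact: subN.
Qed.

End iterated_integrals.

(** * The modulus of a complex number *)

Section complex_modulus.
Context {R : realType}.
Implicit Types (z : R[i]) (a : R).

Lemma normcE z : normc z = Num.sqrt (complex.Re z ^+ 2 + complex.Im z ^+ 2).
Proof. by case: z. Qed.

Lemma normc_ge0 z : 0 <= normc z.
Proof. by rewrite normcE sqrtr_ge0. Qed.

Lemma normr_Re_le z : `|complex.Re z| <= normc z.
Proof. by rewrite normcE -sqrtr_sqr ler_wsqrtr// lerDl sqr_ge0. Qed.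

Lemma normr_Im_le z : `|complex.Im z| <= normc z.
Proof. by rewrite normcE -sqrtr_sqr ler_wsqrtr// lerDr sqr_ge0. Qed.

Lemma normc_le z : normc z <= `|complex.Re z| + `|complex.Im z|.
Proof.
rewrite normcE -[leRHS]ger0_norm ?addr_ge0// -sqrtr_sqr ler_wsqrtr//.
by rewrite sqrrD !real_normK ?num_real// lerD2r lerDl mulrn_wge0// mulr_ge0.
Qed.

Lemma Re_realM a z : complex.Re (a%:C%C * z) = a * complex.Re z.
Proof. by case: z => u v /=; rewrite mul0r subr0. Qed.

Lemma Im_realM a z : complex.Im (a%:C%C * z) = a * complex.Im z.
Proof. by case: z => u v /=; rewrite mul0r addr0. Qed.

Lemma complex_ext z1 z2 : complex.Re z1 = complex.Re z2 ->
  complex.Im z1 = complex.Im z2 -> z1 = z2.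
Proof. by case: z1 z2 => [a b] [c d] /= -> ->. Qed.

Lemma Cmeasurable_normc d (T : measurableType d) (f : T -> R[i]) :
  Cmeasurable f -> measurable_fun setT (fun x => normc (f x)).
Proof.
move=> [mRe mIm].
rewrite (_ : (fun x => _) =
    fun x => (complex.Re (f x) ^+ 2 + complex.Im (f x) ^+ 2) `^ 2^-1).
  apply: (measurableT_comp (measurable_powR _)).
  by apply: measurable_funD; exact: measurable_funX.
by apply/funext => x; rewrite normcE powR12_sqrt// addr_ge0// sqr_ge0.
Qed.

End complex_modulus.

(** * Integrability of the exponential kernel *)

Section laplace_kernel.
Context {R : realType}.
Local Notation mu := (@lebesgue_measure R).
Local Notation pos := (`]0%R, +oo[%classic : set R).
Local Open Scope ereal_scope.

(** On the half-line the q-th power of the kernel is 1 / (q x) times the density of the exponential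
    law of rate q x, which has total mass 1. *)
Lemma laplace_kernel_lty (x q : R) : (0 < x)%R -> (0 < q)%R ->
  \int[mu]_(t in pos) (expR (- (x * t)) `^ q)%:E < +oo.
Proof.
move=> x0 q0; have qx0 : (0 < q * x)%R by exact: mulr_gt0.
have ipdf := integral_exponential_pdf qx0.
have mpdf : measurable_fun setT (EFin \o exponential_pdf (q * x)%R).
  by apply/measurable_EFinP; apply: measurable_exponential_pdf; exact: ltW.
have pdf0 t : 0 <= (exponential_pdf (q * x)%R t)%:E.
  by rewrite lee_fin exponential_pdf_ge0// ltW.
apply: (@le_lt_trans _ _ (\int[mu]_t
    (((q * x)^-1)%:E * (exponential_pdf (q * x)%R t)%:E))); last first.
  by rewrite ge0_integralZl// ?lee_fin ?invr_ge0 ?ltW// ipdf mule1 ltry.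
rewrite integral_mkcond; apply: ae_ge0_le_lower_integral => [t _|t _|].
- by apply: erestrict_ge0 => s _; rewrite lee_fin powR_ge0.
- by rewrite mule_ge0// lee_fin invr_ge0 ltW.
apply: aeW => t _; rewrite patchE; case: ifPn => [|_]; last first.
  by rewrite mule_ge0// lee_fin invr_ge0 ltW.
rewrite inE /= in_itv/= andbT => t0.
rewrite exponential_pdfE; [|exact: ltW..].
rewrite -EFinM mulKf ?gt_eqF// lee_fin /powR gt_eqF ?expR_gt0//.
by rewrite expRK mulrN mulNr mulrA.
Qed.

(** [E] is the L^p' norm of the kernel. It is chosen before [u], so that a single constant serves
    all sections of a function of two variables. *)
Lemma laplace_kernel_hoelder (x p p' : R) : (0 < x)%R -> (0 < p)%R ->
  (0 < p')%R -> (p^-1 + p'^-1 = 1)%R ->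
  exists2 E : R, (0 <= E)%R & forall u : R -> R,
    measurable_fun setT u -> (forall t, 0 <= u t)%R ->
    \int[mu]_(t in pos) (expR (- (x * t)) * u t)%:E <=
    E%:E * (\int[mu]_(t in pos) (u t `^ p)%:E) `^ p^-1.
Proof.
move=> x0 p0 p'0 pp'.
pose E := (\int[mu]_(t in pos) (expR (- (x * t)) `^ p')%:E) `^ p'^-1.
have Efin : E \is a fin_num.
  by rewrite ge0_fin_numE ?poweR_ge0// poweR_lty// laplace_kernel_lty.
exists (fine E); first by rewrite fine_ge0// poweR_ge0.
move=> u mu_ u0; rewrite fineK//; apply: ge0_hoelder => //.
- apply: measurable_funTS; apply: measurableT_comp => //.
  by apply: measurableT_comp => //; exact: mulrl_measurable.
- exact: measurable_funTS.
- by rewrite addrC.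
Qed.

End laplace_kernel.

(** * The one-variable transform and its link with [laplace2] *)

Section laplace_operator.
Context {R : realType}.
Local Notation mu := (@lebesgue_measure R).
Local Notation pos := (`]0%R, +oo[%classic : set R).
Local Open Scope ereal_scope.

Lemma Lp_norm_ge0 p (f : R -> R[i]) : 0 <= Lp_norm p f.
Proof. exact: poweR_ge0. Qed.

Lemma laplace_norm_ge0 (p q : R) : 0 <= laplace_norm p q.
Proof. by apply: le_ereal_inf_tmp => _ [C [C0 _] <-]; rewrite lee_fin. Qed.

Lemma Re_laplace (f : R -> R[i]) x : complex.Re (laplace f x) =
  (\int[mu]_(t in pos) (expR (- (x * t)) * complex.Re (f t)))%R.
Proof. by apply: eq_Rintegral => t _; rewrite Re_realM. Qed.

Lemma Im_laplace (f : R -> R[i]) x : complex.Im (laplace f x) =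
  (\int[mu]_(t in pos) (expR (- (x * t)) * complex.Im (f t)))%R.
Proof. by apply: eq_Rintegral => t _; rewrite Im_realM. Qed.

Lemma measurable_laplace_kernel :
  measurable_fun setT (fun z : R * R => expR (- (z.1 * z.2))).
Proof.
apply: measurableT_comp => //; apply: measurableT_comp => //.
exact: measurable_funM.
Qed.

Lemma ae_eq_Cintegral (f g : R -> R[i]) :
  ae_eq mu pos f g -> Cintegral mu pos f = Cintegral mu pos g.
Proof.
by move=> fg; congr (_ +i* _)%C; apply: ae_eq_Rintegral;
  apply: filterS fg => t fgt /fgt ->.
Qed.

Lemma laplace0 x : laplace (fun=> 0%R : R[i]) x = 0%R.
Proof.
apply: complex_ext.
- rewrite Re_laplace /Rintegral; under eq_integral do rewrite mulr0.
  by rewrite integral0.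
- rewrite Im_laplace /Rintegral; under eq_integral do rewrite mulr0.
  by rewrite integral0.
Qed.

(* If no finite bound exists, the right-hand side is [+oo], except when [f]
   vanishes a.e.: then it is [+oo * 0 = 0]. *)
Lemma laplace_normP (p q : R) (f : R -> R[i]) : (0 < p)%R -> (0 < q)%R ->
  Cmeasurable f -> Lp_norm p f < +oo ->
  Lp_norm q (laplace f) <= laplace_norm p q * Lp_norm p f.
Proof.
move=> p0 q0 mf foo.
have [f0|f0] := eqVneq (Lp_norm p f) 0.
  have int0 :
      \int[mu]_(t in pos) `|(normc (f t) `^ p)%:E| = 0.
    rewrite -[RHS](@poweR_eq0_eq0 _ _ p^-1 _ f0); last first.
      by apply: integral_ge0 => t _; rewrite lee_fin powR_ge0.
    by apply: eq_integral => t _; rewrite gee0_abs// lee_fin powR_ge0.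
  have mnf : measurable_fun pos (fun t => (normc (f t) `^ p)%:E).
    apply: measurable_funTS; apply/measurable_EFinP.
    by apply: (measurableT_comp (measurable_powR p)); exact: Cmeasurable_normc.
  move: int0 => /(ae_eq_integral_abs mu (measurable_itv _) mnf) ae0.
  rewrite f0 mule0 /Lp_norm.
  have Lf x : laplace f x = 0%R.
    rewrite -(laplace0 x); apply: ae_eq_Cintegral; apply: filterS ae0 => t ft /ft.
    by move=> [/powR_eq0_eq0 /ComplexField.Normc.eq0_normc ->].
  under eq_integral do rewrite Lf ComplexField.Normc.normc0 powR0 ?gt_eqF//.
  by rewrite integral0 poweR0r// invr_eq0 gt_eqF.
have fgt0 : 0 < Lp_norm p f by rewrite lt0e f0 Lp_norm_ge0.
have ffin : Lp_norm p f \is a fin_num by rewrite ge0_fin_numE// Lp_norm_ge0.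
(* The norm of [f] is now positive and finite: divided by it, the left-hand side is below every
   admissible [C], hence below their infimum. *)
rewrite -(fineK ffin) -lee_pdivrMr ?fine_gt0 ?fgt0//.
apply: le_ereal_inf_tmp => _ [C [C0 hC] <-].
rewrite lee_pdivrMr ?fine_gt0 ?fgt0// fineK//; apply: hC => //.
exact: Cmeasurable_completed.
Qed.

(** Minkowski's inequality requires joint measurability in the frequency and the free variable;
    measurability of parameter integrals gives it on the space of pairs. *)
Lemma Cmeasurable_laplace (g : R * R -> R[i]) : Cmeasurable g ->
  Cmeasurable (fun z : R * R => laplace (fun t => g (z.2, t)) z.1).
Proof.
move=> [mRe mIm].
have mz : measurable_fun setT (fun z : (R * R) * R => (z.1.1, z.2)).
  by apply: measurable_fun_pair => //; exact: measurableT_comp.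
have mw : measurable_fun setT (fun z : (R * R) * R => (z.1.2, z.2)).
  by apply: measurable_fun_pair => //; exact: measurableT_comp.
split.
- under eq_fun do rewrite Re_laplace.
  apply: (@measurable_fun_Rintegral2 _ _ _ _ _ mu pos _ (fun z : (R * R) * R =>
    (expR (- (z.1.1 * z.2)) * complex.Re (g (z.1.2, z.2)))%R)) => //.
  apply: measurable_funM; first exact: (measurableT_comp measurable_laplace_kernel mz).
  exact: (measurableT_comp mRe mw).
- under eq_fun do rewrite Im_laplace.
  apply: (@measurable_fun_Rintegral2 _ _ _ _ _ mu pos _ (fun z : (R * R) * R =>
    (expR (- (z.1.1 * z.2)) * complex.Im (g (z.1.2, z.2)))%R)) => //.
  apply: measurable_funM; first exact: (measurableT_comp measurable_laplace_kernel mz).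
  exact: (measurableT_comp mIm mw).
Qed.

(** The factor 2 comes from bounding real and imaginary parts separately. It does not reach the
    final constant, since this bound serves only to prove finiteness. *)
Lemma normc_laplace_le (f : R -> R[i]) x : Cmeasurable f ->
  (normc (laplace f x))%:E <=
  2%:E * \int[mu]_(t in pos) (expR (- (x * t)) * normc (f t))%:E.
Proof.
move=> mf; set I := \int[mu]_(t in pos) _.
have I0 : 0 <= I.
  by apply: integral_ge0 => t _; rewrite lee_fin mulr_ge0 ?expR_ge0 ?normc_ge0.
(* An infinite right-hand side is trivial; a finite one makes the integrand integrable, so that
   [fine] discards nothing. *)
have [->|Ioo] := eqVneq I +oo; first by rewrite gt0_muley ?leey// lte_fin.
have part (u : R -> R) : measurable_fun setT u ->
    (forall t, `|u t| <= normc (f t))%R ->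
    `|\int[mu]_(t in pos) (expR (- (x * t)) * u t)|%R%:E <= I.
  move=> mu_ uf.
  have mk : measurable_fun pos (fun t => (expR (- (x * t)) * u t)%R).
    apply: measurable_funTS; apply: measurable_funM => //.
    exact: (measurableT_comp measurable_laplace_kernel (pair1_measurable x)).
  have le_I : \int[mu]_(t in pos) `|(expR (- (x * t)) * u t)%:E| <= I.
    apply: ae_ge0_le_lower_integral => [t _|t _|].
    - exact: abse_ge0.
    - by rewrite lee_fin mulr_ge0 ?expR_ge0 ?normc_ge0.
    apply: aeW => t _; rewrite lee_fin normrM ger0_norm ?expR_ge0//.
    by rewrite ler_wpM2l ?expR_ge0.
  rewrite EFin_normr_Rintegral//; last first.
    apply/integrableP; split; first exact/measurable_EFinP.
    by rewrite (le_lt_trans le_I)// ltey.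
  by apply: le_trans le_I; apply: le_abse_integral => //; exact/measurable_EFinP.
rewrite -[2%:E]/((1 + 1)%:E) EFinD ge0_muleDl// !mul1e.
apply: (@le_trans _ _ ((`|complex.Re (laplace f x)| +
    `|complex.Im (laplace f x)|)%R%:E)); first by rewrite lee_fin normc_le.
rewrite EFinD Re_laplace Im_laplace; case: mf => mRe mIm; apply: leeD.
- by apply: part => // t; exact: normr_Re_le.
- by apply: part => // t; exact: normr_Im_le.
Qed.

Lemma laplace2_Fubini (g : R * R -> R[i]) x1 x2 : Cmeasurable g ->
  \int[mu]_(t1 in pos) \int[mu]_(t2 in pos)
    (expR (- (x1 * t1)) * (expR (- (x2 * t2)) * normc (g (t1, t2))))%:E < +oo ->
  laplace2 g (x1, x2) =
  laplace (fun t1 => laplace (fun t2 => g (t1, t2)) x2) x1.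
Proof.
move=> mg goo.
have part (u : R * R -> R) : measurable_fun setT u ->
    (forall z, `|u z| <= normc (g z))%R ->
    (\int[mu]_(t2 in pos) \int[mu]_(t1 in pos)
      (expR (- (x1 * t1) - x2 * t2) * u (t1, t2)) =
    \int[mu]_(t1 in pos) (expR (- (x1 * t1)) *
      \int[mu]_(t2 in pos) (expR (- (x2 * t2)) * u (t1, t2))))%R.
  move=> mu_ ug.
  pose k z := (expR (- (x1 * z.1)) * (expR (- (x2 * z.2)) * u z))%R.
  have mk : measurable_fun setT k.
    apply: measurable_funM.
      by do 3 apply: measurableT_comp => //; exact: mulrl_measurable.
    apply: measurable_funM => //.
    by do 3 apply: measurableT_comp => //; exact: mulrl_measurable.
  have ik : \int[mu]_(t1 in pos) \int[mu]_(t2 in pos) `|(k (t1, t2))%:E| < +oo.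
    apply: le_lt_trans goo; apply: ae_ge0_le_lower_integral => [t1 _|t1 _|].
    - by apply: integral_ge0 => t2 _; exact: abse_ge0.
    - by apply: integral_ge0 => t2 _; rewrite lee_fin !mulr_ge0 ?expR_ge0 ?normc_ge0.
    apply: aeW => t1 _; apply: ae_ge0_le_lower_integral => [t2 _|t2 _|].
    - exact: abse_ge0.
    - by rewrite lee_fin !mulr_ge0 ?expR_ge0 ?normc_ge0.
    apply: aeW => t2 _; rewrite lee_fin /k !normrM.
    by rewrite !(ger0_norm (expR_ge0 _)) !ler_wpM2l ?expR_ge0.
  transitivity (\int[mu]_(t2 in pos) \int[mu]_(t1 in pos) k (t1, t2))%R.
    apply: eq_Rintegral => t2 _; apply: eq_Rintegral => t1 _.
    by rewrite /k /= expRD mulrA.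
  rewrite (@Rintegral_Fubini _ _ _ _ _ mu mu pos pos _ _ _ mk ik)//.
  apply: ae_eq_Rintegral.
  have := @ae_integrable_section1 _ _ _ _ _ mu mu pos pos
    (measurable_itv _) (measurable_itv _) _ mk ik.
  apply: filterS => t1 /[apply] ik1; rewrite -RintegralZl//.
  (* Taking the factor in [t1] out of the inner integral requires integrability without that factor,
     which is recovered by multiplying the section of [k] by the inverse exponential. *)
  have : mu.-integrable pos (fun t2 => (expR (x1 * t1))%:E * (k (t1, t2))%:E).
    exact: integrableZl.
  apply: eq_integrable => // t2 _.
  by rewrite /k /= -EFinM (mulrA (expR (x1 * t1))) -expRD subrr expR0 mul1r.
case: (mg) => mRe mIm; apply: complex_ext.
- rewrite Re_laplace /laplace2 /Cintegral /=.
  under eq_Rintegral do under eq_Rintegral do rewrite Re_realM.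
  rewrite [LHS](part _ mRe)//; last by move=> z; exact: normr_Re_le.
  apply: eq_Rintegral => t1 _; congr (_ * _)%R.
  by apply: eq_Rintegral => t2 _; rewrite Re_realM.
- rewrite Im_laplace /laplace2 /Cintegral /=.
  under eq_Rintegral do under eq_Rintegral do rewrite Im_realM.
  rewrite [LHS](part _ mIm)//; last by move=> z; exact: normr_Im_le.
  apply: eq_Rintegral => t1 _; congr (_ * _)%R.
  by apply: eq_Rintegral => t2 _; rewrite Im_realM.
Qed.

End laplace_operator.

(** * Mixed norms and the inequality for Borel functions *)

Section permuted_mixed_norms.
Context {R : realType}.
Local Notation mu := (@lebesgue_measure R).
Local Notation pos := (`]0%R, +oo[%classic : set R).
Local Open Scope ereal_scope.

Lemma ge0_integral_posZl (c : \bar R) (F : R -> \bar R) :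
  0 <= c -> measurable_fun setT F -> (forall t, 0 <= F t) ->
  \int[mu]_(t in pos) (c * F t) = c * \int[mu]_(t in pos) F t.
Proof.
by move=> c0 mF F0; apply: ge0_integralZl => //; exact: measurable_funTS.
Qed.

Lemma measurable_laplace_integrand (x : R) (f : R -> R[i]) : Cmeasurable f ->
  measurable_fun setT (fun t => (expR (- (x * t)) * normc (f t))%:E).
Proof.
move=> mf; apply/measurable_EFinP; apply: measurable_funM.
  exact: (measurableT_comp measurable_laplace_kernel (pair1_measurable x)).
exact: Cmeasurable_normc.
Qed.

Lemma eq_Lp_norm (p : R) (f1 f2 : R -> R[i]) :
  (forall t, (0 < t)%R -> f1 t = f2 t) -> Lp_norm p f1 = Lp_norm p f2.
Proof.
move=> f12; apply: (congr1 (fun I => I `^ p^-1)); apply: eq_integral => t.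
by rewrite inE /= in_itv/= andbT => /f12 ->.
Qed.

Lemma mixed_norm_2inE (p q : R) (h : R * R -> R[i]) : mixed_norm_2in p q h =
  (\int[mu]_(x1 in pos) Lp_norm p (fun x2 => h (x1, x2)) `^ q) `^ q^-1.
Proof.
congr (_ `^ _); apply: eq_integral => x1 _.
by rewrite /Lp_norm -poweRrM mulrC.
Qed.

Lemma mixed_norm_1inE (p q : R) (h : R * R -> R[i]) : mixed_norm_1in p q h =
  (\int[mu]_(x2 in pos) Lp_norm p (fun x1 => h (x1, x2)) `^ q) `^ q^-1.
Proof.
congr (_ `^ _); apply: eq_integral => x2 _.
by rewrite /Lp_norm -poweRrM mulrC.
Qed.

Lemma measurable_Lp_norm2 (p : R) (h : R * R -> R[i]) : Cmeasurable h ->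
  measurable_fun setT (fun x1 => Lp_norm p (fun x2 => h (x1, x2))).
Proof.
move=> mh; apply: (measurableT_comp (measurable_poweR _)).
apply: (@measurable_fun_ge0_integral2 _ _ _ _ _ mu pos _
  (fun z => (normc (h z) `^ p)%:E)) => //.
  apply/measurable_EFinP; apply: (measurableT_comp (measurable_powR p)).
  exact: Cmeasurable_normc.
by move=> z; rewrite lee_fin powR_ge0.
Qed.

Lemma Cmeasurable_section (h : R * R -> R[i]) x1 : Cmeasurable h ->
  Cmeasurable (fun x2 => h (x1, x2)).
Proof.
case=> mRe mIm; split.
- exact: (measurableT_comp mRe (pair1_measurable x1)).
- exact: (measurableT_comp mIm (pair1_measurable x1)).
Qed.

Lemma Lp_norm_kernel_le (x p p' : R) : (0 < x)%R -> (0 < p)%R ->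
  (0 < p')%R -> (p^-1 + p'^-1 = 1)%R ->
  exists2 E : R, (0 <= E)%R & forall f : R -> R[i], Cmeasurable f ->
    \int[mu]_(t in pos) (expR (- (x * t)) * normc (f t))%:E <=
    E%:E * Lp_norm p f.
Proof.
move=> x0 p0 p'0 pp'; have [E E0 hE] := laplace_kernel_hoelder x0 p0 p'0 pp'.
exists E => // f mf; apply: hE; first exact: Cmeasurable_normc.
by move=> t; exact: normc_ge0.
Qed.

Section borel.
Variables (p1 p2 p1' p2' : R).
Hypotheses (p10 : (0 < p1)%R) (p20 : (0 < p2)%R) (p1'0 : (0 < p1')%R)
  (p2'0 : (0 < p2')%R).
Hypotheses (pp1 : (p1^-1 + p1'^-1 = 1)%R) (pp2 : (p2^-1 + p2'^-1 = 1)%R).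
Variable g : R * R -> R[i].
Hypotheses (mg : Cmeasurable g) (goo : mixed_norm_2in p2 p1 g < +oo).

Let N t1 := Lp_norm p2 (fun t2 => g (t1, t2)).

Let mN : measurable_fun setT N.
Proof. exact: measurable_Lp_norm2. Qed.

Let mNp1 : measurable_fun setT (fun t1 => N t1 `^ p1).
Proof. exact: (measurableT_comp (measurable_poweR _)). Qed.

Let N0 t1 : 0 <= N t1. Proof. exact: Lp_norm_ge0. Qed.

Let intN : \int[mu]_(t1 in pos) N t1 `^ p1 < +oo.
Proof.
apply: (@lty_poweRy _ _ p1^-1); first by rewrite invr_eq0 gt_eqF.
by rewrite -mixed_norm_2inE.
Qed.

(** A finite outer norm makes the inner norm finite only for almost every [t1], so bounds at fixed
    [t1] that need it finite are used a.e. *)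
Let Nfin : {ae mu, forall t1, pos t1 -> N t1 \is a fin_num}.
Proof.
have iN : mu.-integrable pos (fun t1 => N t1 `^ p1).
  apply/integrableP; split; first exact: measurable_funTS.
  by under eq_integral do rewrite gee0_abs ?poweR_ge0//.
have := @integrable_ae _ _ _ mu pos (measurable_itv _) _ iN.
apply: filterS => t1 Nt1 t10.
rewrite ge0_fin_numE//; apply: (@lty_poweRy _ _ p1); first by rewrite gt_eqF.
by rewrite -ge0_fin_numE ?poweR_ge0//; exact: Nt1.
Qed.

Let integrable_kernel x1 x2 : (0 < x1)%R -> (0 < x2)%R ->
  \int[mu]_(t1 in pos) \int[mu]_(t2 in pos)
    (expR (- (x1 * t1)) * (expR (- (x2 * t2)) * normc (g (t1, t2))))%:E < +oo.
Proof.
move=> x10 x20.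
have [E2 E20 hE2] := Lp_norm_kernel_le x20 p20 p2'0 pp2.
have [E1 E10 hE1] := laplace_kernel_hoelder x10 p10 p1'0 pp1.
(* Hölder's inequality in [t1] takes a real function; [u] differs from [N] only where [N] is
   infinite, a null part of the half-line. *)
pose u t1 := fine (N t1).
have u0 t1 : (0 <= u t1)%R by exact: fine_ge0.
have mu_ : measurable_fun setT u by exact: measurableT_comp.
apply: (@le_lt_trans _ _
    (E2%:E * \int[mu]_(t1 in pos) (expR (- (x1 * t1)) * u t1)%:E)).
  rewrite -ge0_integral_posZl//; last 2 first.
  - apply/measurable_EFinP; apply: measurable_funM => //.
    exact: (measurableT_comp measurable_laplace_kernel (pair1_measurable x1)).
  - by move=> t1; rewrite lee_fin mulr_ge0 ?expR_ge0.
  apply: ae_ge0_le_lower_integral => [t1 _|t1 _|].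
  - by apply: integral_ge0 => t2 _; rewrite lee_fin !mulr_ge0 ?expR_ge0 ?normc_ge0.
  - by rewrite mule_ge0// lee_fin mulr_ge0 ?expR_ge0.
  apply: ae_imply Nfin => t1 /[apply] Nt1.
  under eq_integral => t2 _ do rewrite EFinM.
  rewrite ge0_integral_posZl; last 3 first.
  - by rewrite lee_fin expR_ge0.
  - by apply: measurable_laplace_integrand; exact: Cmeasurable_section.
  - by move=> t2; rewrite lee_fin mulr_ge0 ?expR_ge0 ?normc_ge0.
  rewrite EFinM fineK// muleCA lee_wpmul2l ?lee_fin ?expR_ge0//.
  by apply: hE2; exact: Cmeasurable_section.
have /le_lt_trans : E2%:E * \int[mu]_(t1 in pos) (expR (- (x1 * t1)) * u t1)%:E
    <= E2%:E * (E1%:E * (\int[mu]_(t1 in pos) N t1 `^ p1) `^ p1^-1).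
  rewrite lee_wpmul2l ?lee_fin//; apply: le_trans (hE1 u mu_ u0) _.
  rewrite lee_wpmul2l ?lee_fin//; apply: lee_poweR.
  - by rewrite invr_ge0 ltW.
  - by apply: integral_ge0 => t1 _; rewrite lee_fin powR_ge0.
  apply: ae_ge0_le_lower_integral => [t1 _|t1 _|].
  - by rewrite lee_fin powR_ge0.
  - exact: poweR_ge0.
  by apply: ae_imply Nfin => t1 /[apply] Nt1; rewrite -poweR_EFin fineK.
apply; rewrite -mixed_norm_2inE muleA -EFinM lte_mul_pinfty// lee_fin.
by rewrite mulr_ge0.
Qed.

Let h x2 t1 := laplace (fun t2 => g (t1, t2)) x2.

Let mh : Cmeasurable (fun z => h z.1 z.2).
Proof. exact: Cmeasurable_laplace. Qed.

Let mhx x2 : Cmeasurable (h x2).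
Proof. exact: (Cmeasurable_section x2 mh). Qed.

(** The bound C(p1) can be applied to [h x2] only if its norm is finite. Hölder in [t2] bounds
    [h x2 t1] by 2 E N(t1), where [E] depends on [x2] but not on [t1]. *)
Let hoo x2 : (0 < x2)%R -> Lp_norm p1 (h x2) < +oo.
Proof.
move=> x20; have [E E0 hE] := Lp_norm_kernel_le x20 p20 p2'0 pp2.
apply: poweR_lty.
apply: (@le_lt_trans _ _
    (\int[mu]_(t1 in pos) (((2 * E) `^ p1)%:E * N t1 `^ p1))).
  apply: ae_ge0_le_lower_integral => [t1 _|t1 _|].
  - by rewrite lee_fin powR_ge0.
  - by rewrite mule_ge0 ?poweR_ge0// lee_fin powR_ge0.
  apply: aeW => t1 _; rewrite -!poweR_EFin -poweRM ?lee_fin ?mulr_ge0//.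
  apply: lee_poweR; [exact: ltW|by rewrite lee_fin normc_ge0|].
  apply: le_trans (normc_laplace_le _ _) _; first exact: Cmeasurable_section.
  rewrite EFinM -muleA lee_wpmul2l ?lee_fin//.
  by apply: hE; exact: Cmeasurable_section.
rewrite ge0_integral_posZl ?lee_fin ?powR_ge0//; last first.
  by move=> t1; exact: poweR_ge0.
by rewrite lte_mul_pinfty// lee_fin powR_ge0.
Qed.

Lemma laplace2_mixed_norm_borel : (p1 <= p2')%R ->
  mixed_norm_1in p1' p2' (laplace2 g) <=
  laplace_norm p1 p1' * laplace_norm p2 p2' * mixed_norm_2in p2 p1 g.
Proof.
move=> p12; set C1 := laplace_norm p1 p1'; set C2 := laplace_norm p2 p2'.
have C10 : 0 <= C1 by exact: laplace_norm_ge0.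
have C20 : 0 <= C2 by exact: laplace_norm_ge0.
have scale (C : \bar R) (q : R) (F : R -> \bar R) : 0 <= C -> (0 < q)%R ->
    measurable_fun setT F -> (forall x, 0 <= F x) ->
    (\int[mu]_(x in pos) (C * F x) `^ q) `^ q^-1 =
    C * (\int[mu]_(x in pos) F x `^ q) `^ q^-1.
  move=> C0 q0 mF F0.
  under eq_integral do rewrite poweRM//.
  rewrite ge0_integral_posZl ?poweR_ge0//; last 2 first.
  - exact: (measurableT_comp (measurable_poweR _)).
  - by move=> x; exact: poweR_ge0.
  rewrite poweRM ?poweR_ge0//; last first.
    by apply: integral_ge0 => x _; exact: poweR_ge0.
  by rewrite -poweRrM mulfV ?gt_eqF// poweRe1.
have mono (q : R) (F G : R -> \bar R) : (0 < q)%R ->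
    (forall x, 0 <= F x) -> (forall x, 0 <= G x) ->
    {ae mu, forall x, pos x -> F x <= G x} ->
    (\int[mu]_(x in pos) F x `^ q) `^ q^-1 <=
    (\int[mu]_(x in pos) G x `^ q) `^ q^-1.
  move=> q0 F0 G0 FG; apply: lee_poweR; first by rewrite invr_ge0 ltW.
    by apply: integral_ge0 => x _; exact: poweR_ge0.
  apply: ae_ge0_le_lower_integral => [x _|x _|]; [exact: poweR_ge0..|].
  by apply: ae_imply FG => x /[apply] FGx; apply: lee_poweR => //; exact: ltW.
have step1 : mixed_norm_1in p1' p2' (laplace2 g) <=
    C1 * (\int[mu]_(x2 in pos) Lp_norm p1 (h x2) `^ p2') `^ p2'^-1.
  rewrite mixed_norm_1inE -scale//; last 2 first.
  - exact: (measurable_Lp_norm2 p1 mh).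
  - by move=> x2; exact: Lp_norm_ge0.
  apply: mono => //.
  - by move=> x2; exact: Lp_norm_ge0.
  - by move=> x2; rewrite mule_ge0// Lp_norm_ge0.
  apply: aeW => x2; rewrite /= in_itv/= andbT => x20.
  have -> : Lp_norm p1' (fun x1 => laplace2 g (x1, x2)) =
      Lp_norm p1' (laplace (h x2)).
    apply: eq_Lp_norm => x1 x10.
    exact: (laplace2_Fubini mg (integrable_kernel x10 x20)).
  exact: (laplace_normP p10 p1'0 (mhx x2) (hoo x20)).
have step2 : (\int[mu]_(x2 in pos) Lp_norm p1 (h x2) `^ p2') `^ p2'^-1 <=
    (\int[mu]_(t1 in pos) Lp_norm p2' (h^~ t1) `^ p1) `^ p1^-1.
  (* Minkowski is applied to |h|^p1 with exponent r = p2' / p1: the r-th power of its integral in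
     [t1] is the p2'-th power of the L^p1 norm, and H^r = |h|^p2'. *)
  pose H z := (normc (h z.1 z.2) `^ p1)%R.
  have mH : measurable_fun setT H.
    apply: (measurableT_comp (measurable_powR p1)).
    exact: Cmeasurable_normc mh.
  have H0 z : (0 <= H z)%R by exact: powR_ge0.
  have r1 : (1 <= p2' / p1)%R by rewrite ler_pdivlMr// mul1r.
  have hm : \int[mu]_(x2 in pos) Lp_norm p1 (h x2) `^ p2' <=
      (\int[mu]_(t1 in pos) Lp_norm p2' (h^~ t1) `^ p1) `^ (p2' / p1).
    have -> : \int[mu]_(x2 in pos) Lp_norm p1 (h x2) `^ p2' =
        \int[mu]_(x2 in pos) (\int[mu]_(t1 in pos) (H (x2, t1))%:E) `^ (p2' / p1).
      by apply: eq_integral => x2 _; rewrite /Lp_norm -poweRrM mulrC.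
    have -> : \int[mu]_(t1 in pos) Lp_norm p2' (h^~ t1) `^ p1 =
        \int[mu]_(t1 in pos) (\int[mu]_(x2 in pos)
          (H (x2, t1) `^ (p2' / p1))%:E) `^ (p2' / p1)^-1.
      apply: eq_integral => t1 _; rewrite /Lp_norm -poweRrM invf_div mulrC.
      under [in RHS]eq_integral => x2 _ do
        rewrite /H -powRrM mulrCA divff ?gt_eqF// mulr1.
      by [].
    exact: minkowski_integral_restrict.
  (* It remains to take p2'-th roots in [hm]. *)
  rewrite (_ : p1^-1 = p2' / p1 * p2'^-1)%R; last first.
    by rewrite mulrAC divff ?mul1r// gt_eqF.
  rewrite poweRrM; apply: lee_poweR => //; first by rewrite invr_ge0 ltW.
  by apply: integral_ge0 => x2 _; exact: poweR_ge0.
have step3 : (\int[mu]_(t1 in pos) Lp_norm p2' (h^~ t1) `^ p1) `^ p1^-1 <=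
    C2 * mixed_norm_2in p2 p1 g.
  rewrite mixed_norm_2inE -scale//; apply: mono => //.
  - by move=> t1; exact: Lp_norm_ge0.
  - by move=> t1; rewrite mule_ge0// Lp_norm_ge0.
  apply: ae_imply Nfin => t1 /[apply] Nt1; apply: laplace_normP => //.
    exact: Cmeasurable_section.
  by rewrite -ge0_fin_numE ?Lp_norm_ge0.
by rewrite -muleA; apply: le_trans step1 _; rewrite lee_wpmul2l// (le_trans step2).
Qed.

End borel.

(** * Invariance of both sides under changes on null sets *)

Lemma ae_eq_Lp_norm (p : R) (f1 f2 : R -> R[i]) :
  ae_eq mu pos f1 f2 -> Lp_norm p f1 = Lp_norm p f2.
Proof.
move=> f12; apply: (congr1 (fun I => I `^ p^-1)).
apply: ae_eq_lower_integral.
by apply: ae_imply f12 => t /[apply] ->.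
Qed.

Lemma ae_eq_mixed_norm_2in (p q : R) (f g : R * R -> R[i]) :
  ae_eq (mu \x mu) (pos `*` pos) f g ->
  mixed_norm_2in p q f = mixed_norm_2in p q g.
Proof.
move=> /ae_xsection fg; rewrite !mixed_norm_2inE.
apply: (congr1 (fun I => I `^ q^-1)); apply: ae_eq_lower_integral.
apply: ae_imply fg => t1 fgt1 t10.
rewrite (@ae_eq_Lp_norm _ _ (fun t2 => g (t1, t2)))//.
by apply: ae_imply fgt1 => t2 fgt2 t20; apply: fgt2.
Qed.

(** Equality holds at every [x], since a null set of the product affects neither integral. As [t1]
    is the inner variable, the sections are taken at fixed [t2]. *)
Lemma ae_eq_laplace2 (f g : R * R -> R[i]) x :
  ae_eq (mu \x mu) (pos `*` pos) f g -> laplace2 f x = laplace2 g x.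
Proof.
move=> /ae_ysection fg; apply: ae_eq_Cintegral.
apply: ae_imply fg => t2 fgt2 t20; apply: ae_eq_Cintegral.
by apply: ae_imply fgt2 => t1 fgt1 t10; rewrite fgt1.
Qed.

End permuted_mixed_norms.

Theorem corollary2p2 (R : realType) (p1 p2 p1' p2' : R)
    (hp1 : 1 < p1 <= 2) (hp2 : 1 < p2 <= 2)
    (hp1' : p1^-1 + p1'^-1 = 1) (hp2' : p2^-1 + p2'^-1 = 1)
    (f : R * R -> R[i]) (mf : lebesgue_measurable2 f)
    (nf : (mixed_norm_2in p2 p1 f < +oo)%E) :
  (mixed_norm_1in p1' p2' (laplace2 f) <=
   laplace_norm p1 p1' * laplace_norm p2 p2' * mixed_norm_2in p2 p1 f)%E.
Proof.
have [|g mg fg] := completed_measurable_fun_ae _ mf; first exact: measurableX.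
(* In 1/p' = 1 - 1/p, the bound p > 1 makes the right-hand side positive and p <= 2 makes it at most
   1/2. *)
have conjE (p p' : R) : 1 < p <= 2 -> p^-1 + p'^-1 = 1 -> 0 < p /\ 2 <= p'.
  move=> /andP[p_gt1 p_le2] pp'; have p0 : 0 < p by exact: lt_trans p_gt1.
  split=> //; have p'E : p'^-1 = 1 - p^-1 by rewrite -pp' addrAC subrr add0r.
  have p'V0 : 0 < p'^-1 by rewrite p'E subr_gt0 invf_lt1.
  have pV2 : 2^-1 <= p^-1 by rewrite lef_pV2 ?posrE.
  have p'0 : 0 < p' by rewrite -invr_gt0.
  by rewrite -lef_pV2 ?posrE// p'E lerBlDl -lerBlDr; lra.
have [p10 p1'2] := conjE _ _ hp1 hp1'.
have [p20 p2'2] := conjE _ _ hp2 hp2'.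
rewrite (ae_eq_mixed_norm_2in _ _ fg).
rewrite (_ : laplace2 f = laplace2 g); last first.
  by apply/funext => x; exact: ae_eq_laplace2.
have p1'0 : 0 < p1' by exact: lt_le_trans p1'2.
have p2'0 : 0 < p2' by exact: lt_le_trans p2'2.
have goo : (mixed_norm_2in p2 p1 g < +oo)%E.
  by rewrite -(ae_eq_mixed_norm_2in p2 p1 fg).
have p12 : p1 <= p2' by apply: le_trans p2'2; case/andP: hp1.
exact: (laplace2_mixed_norm_borel p10 p20 p1'0 p2'0 hp1' hp2' mg goo p12).
Qed.
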